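(* Let $n\ge 1$ and $s\ge 0$ be integers, let $I\subseteq \mathbb{R}[x_1,\ldots,x_n]$ be an ideal, and let $\mathcal{A}\subseteq \mathbb{R}^n$ be an $s$-distance set such that every polynomial from $I$ vanishes on $\mathcal{A}$. Then $$|\mathcal{A}|\leq h_{\mathbb{R}[x_1,\ldots,x_n]/I}(s).$$
   Context: For $\mathcal{A}\subseteq\mathbb{R}^n$, let $d(\mathcal{A})=\{d(p_1,p_2): p_1,p_2\in\mathcal{A},\ p_1\neq p_2\}$ be the set of non-zero Euclidean distances among points of $\mathcal{A}$. The set $\mathcal{A}$ is an $s$-distance set if $|d(\mathcal{A})|\le s$. For a field $\mathbb{F}$ and a subset $Y$ of $S=\mathbb{F}[x_1,\ldots,x_n]$, $Y_{\le s}$ denotes the set of polynomials in $Y$ of (total) degree at most $s$. For an ideal $I$ of $S$, the (affine) Hilbert function of $S/I$ is defined by $h_{S/I}(s)=\dim_{\mathbb{F}}\big(S_{\le s}/I_{\le s}\big)$ for integers $s\ge 0$. *)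

(* Defs.v *)
From HB Require Import structures.
From mathcomp Require Import all_boot all_order all_algebra.
From mathcomp Require Import boolp classical_sets functions cardinality reals.
From mathcomp Require Import mpoly.

Set Implicit Arguments.
Unset Strict Implicit.
Unset Printing Implicit Defensive.

Import GRing.Theory.

Local Open Scope ring_scope.
Local Open Scope quotient_scope.

(* An ideal of the commutative ring S is a submodule of S over itself. The
   ideals of ring_quotient are not used because they exclude the unit ideal.
   Membership is boolean, which is no restriction thanks to boolp.asbool. *)
Notation ideal S := (submodClosed S^o).

Section QuotientSpace.
Variables (K : fieldType) (V : vectType K) (U : {vspace V}).

Definition quot_space : Type := Quotient.quot U.

HB.instance Definition _ := GRing.Zmodule.on quot_space.

Definition quot_scale (a : K) (x : quot_space) : quot_space :=
  \pi_(Quotient.quot U) (a *: repr x).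

Lemma pi_eqP (x y : V) :
  reflect (\pi_(Quotient.quot U) x = \pi_(Quotient.quot U) y) (x - y \in U).
Proof. by rewrite Quotient.idealrBE; apply: eqP. Qed.

Lemma pi_scale a x : quot_scale a (\pi_(Quotient.quot U) x) = \pi_(Quotient.quot U) (a *: x).
Proof.
apply/pi_eqP; rewrite -scalerBr rpredZ //.
by apply/pi_eqP; rewrite reprK.
Qed.

Lemma pi_add (x y : V) :
  \pi_(Quotient.quot U) x + \pi_(Quotient.quot U) y = \pi_(Quotient.quot U) (x + y) :> Quotient.quot U.
Proof. by rewrite !piE. Qed.

Lemma quot_spaceW (P : quot_space -> Prop) :
  (forall x, P (\pi_(Quotient.quot U) x)) -> forall x, P x.
Proof. by move=> Ppi x; rewrite -[x]reprK. Qed.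

Fact quot_scaleA a b x :
  quot_scale a (quot_scale b x) = quot_scale (a * b) x.
Proof. by elim/quot_spaceW: x => x; rewrite !pi_scale scalerA. Qed.

Fact quot_scale1 : left_id 1 quot_scale.
Proof. by elim/quot_spaceW => x; rewrite pi_scale scale1r. Qed.

Fact quot_scaleDr : right_distributive quot_scale +%R.
Proof.
move=> a; elim/quot_spaceW => x; elim/quot_spaceW => y.
by rewrite pi_add !pi_scale pi_add scalerDr.
Qed.

Fact quot_scaleDl x : {morph quot_scale^~ x : a b / a + b}.
Proof.
by move=> a b /=; elim/quot_spaceW: x => x; rewrite !pi_scale pi_add scalerDl.
Qed.

HB.instance Definition _ := GRing.Zmodule_isLmodule.Build K quot_space
  quot_scaleA quot_scale1 quot_scaleDr quot_scaleDl.

Fact quot_space_vect_iso : Vector.axiom (\dim U^C) quot_space.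
Proof.
pose c (x : V) := \row_i coord (vbasis U^C) i (daddv_pi U^C U x).
have dUC : (U^C :&: U = 0)%VS by rewrite capvC capv_compl.
have c_lin : linear c.
  by move=> a x y; apply/rowP => i; rewrite !mxE !linearP.
have cU x : x \in U -> c x = 0.
  move=> xU; apply/rowP => i; rewrite !mxE.
  have : x = daddv_pi U^C U x + daddv_pi U U^C x.
    by rewrite daddv_pi_add // addvC addv_complf memvf.
  rewrite (daddv_pi_id _ xU) 1?capvC// -{1}[x]add0r => /addIr <-.
  by rewrite linear0.
have c_pi x : c (repr (\pi_(Quotient.quot U) x)) = c x.
  have /cU : repr (\pi_(Quotient.quot U) x) - x \in U by apply/pi_eqP; rewrite reprK.
  rewrite -[X in c X]addrC -scaleN1r c_lin scaleN1r addrC.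
  by move/eqP; rewrite subr_eq0 => /eqP.
exists (fun x : quot_space => c (repr (x : Quotient.quot U))).
  move=> a; elim/quot_spaceW => x; elim/quot_spaceW => y.
  have -> : a *: (\pi_(Quotient.quot U) x : quot_space) + \pi_(Quotient.quot U) y
            = \pi_(Quotient.quot U) (a *: x + y).
    by rewrite [a *: _]pi_scale pi_add.
  by rewrite !c_pi c_lin.
pose g (r : 'rV_(\dim U^C)) : V := \sum_i r 0 i *: (vbasis U^C)`_i.
have gUC r : g r \in (U^C)%VS.
  by apply: rpred_sum => i _; rewrite rpredZ ?vbasis_mem ?memt_nth.
exists (fun r => \pi_(Quotient.quot U) (g r)).
  elim/quot_spaceW => x; rewrite c_pi; apply/pi_eqP.
  have -> : g (c x) = daddv_pi U^C U x.
    rewrite [RHS](coord_vbasis (memv_pi _ _ _)).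
    by apply: eq_bigr => i _; rewrite mxE.
  have {2}-> : x = daddv_pi U^C U x + daddv_pi U U^C x.
    by rewrite daddv_pi_add // addvC addv_complf memvf.
  by rewrite opprD addrA subrr sub0r rpredN memv_pi.
move=> r; rewrite c_pi; apply/rowP => i; rewrite mxE daddv_pi_id //.
by rewrite coord_sum_free // (basis_free (vbasisP _)).
Qed.

HB.instance Definition _ :=
  Lmodule_hasFinDim.Build K quot_space quot_space_vect_iso.

End QuotientSpace.

Section BoundedDegree.
Variables (n : nat) (F : fieldType) (s : nat).

(* msize p is the total degree of p plus one, and 0 for p = 0. *)
Definition deg_le : {pred {mpoly F[n]}} := [pred p | (msize p <= s.+1)%N].

Fact deg_le_submod_closed : subsemimod_closed deg_le.
Proof.
split; [split|].
- by rewrite inE msize0.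
- move=> p q; rewrite !inE => hp hq; apply: leq_trans (msizeD_le _ _) _.
  by rewrite geq_max hp.
- by move=> a p; rewrite !inE; apply: leq_trans (msizeZ_le _ _).
Qed.

HB.instance Definition _ :=
  GRing.isSubmodClosed.Build F {mpoly F[n]} deg_le deg_le_submod_closed.

Record mpoly_le :=
  MPolyLe { mpoly_of_le :> {mpoly F[n]}; _ : mpoly_of_le \in deg_le }.

HB.instance Definition _ := [isSub for mpoly_of_le].
HB.instance Definition _ := [Choice of mpoly_le by <:].
HB.instance Definition _ := [SubChoice_isSubLmodule of mpoly_le by <:].

Fact mpoly_le_vect_iso : Vector.axiom #|{: 'X_{1..n < s.+1}}| mpoly_le.
Proof.
pose mon (i : 'I_#|{: 'X_{1..n < s.+1}}|) : 'X_{1..n < s.+1} := enum_val i.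
exists (fun p : mpoly_le => \row_i (p : {mpoly F[n]})@_(mon i)).
  by move=> a p q; apply/rowP => i; rewrite !mxE /= mcoeffD mcoeffZ.
pose g (r : 'rV[F]_#|{: 'X_{1..n < s.+1}}|) : {mpoly F[n]} :=
  \sum_(m : 'X_{1..n < s.+1}) r 0 (enum_rank m) *: 'X_[m].
have g_le r : g r \in deg_le.
  by apply: rpred_sum => m _; rewrite rpredZ // inE msizeX bmdeg.
exists (fun r => MPolyLe (g_le r)).
  move=> [p p_le]; apply: val_inj => /=; rewrite /g [RHS](mpolywE p_le).
  by apply: eq_bigr => m _; rewrite mxE /mon enum_rankK.
move=> r; apply/rowP => i; rewrite mxE /= /g.
pose E m := if insub m is Some m' then r 0 (enum_rank (m' : 'X_{1..n < s.+1}))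
            else 0.
rewrite (eq_bigr (fun m : 'X_{1..n < s.+1} => E m *: 'X_[m])); last first.
  by move=> m _; rewrite /E valK.
rewrite linear_sum (bigD1 (mon i)) //= big1 ?addr0 => [|m ne_m].
  by rewrite mcoeffZ mcoeffX eqxx mulr1 /E valK /mon enum_valK.
by rewrite mcoeffZ mcoeffX -bmeqP (negbTE ne_m) mulr0.
Qed.

HB.instance Definition _ := Lmodule_hasFinDim.Build F mpoly_le mpoly_le_vect_iso.

End BoundedDegree.

Lemma vspace_of_closed (K : fieldType) (V : vectType K) (P : V -> Prop) :
  P 0 -> (forall a u v, P u -> P v -> P (a *: u + v)) ->
  exists U : {vspace V}, forall v, v \in U <-> P v.
Proof.
move=> P0 PD.
pose Q k := `[< exists2 U : {vspace V}, \dim U = k & forall v, v \in U -> P v >].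
have Q0 : exists k, Q k.
  exists 0%N; apply/asboolP; exists 0%VS; first exact: dimv0.
  by move=> v; rewrite memv0 => /eqP ->.
have Qle k : Q k -> (k <= \dim {:V})%N.
  by move=> /asboolP[U <- _]; apply: dimvS (subvf _).
case: (ex_maxnP Q0 Qle) => k /asboolP[U dU UP] kmax; exists U => v.
split=> [|Pv]; first exact: UP.
have /kmax : Q (\dim (<[v]> + U)).
  apply/asboolP; exists (<[v]> + U)%VS => // w.
  by case/memv_addP=> _ /vlineP[a ->] [u uU ->]; apply: PD => //; apply: UP.
rewrite -dU => le_dim.
have /eqP UE : (U == <[v]> + U)%VS by rewrite eqEdim addvSr.
by rewrite UE memvE addvSl.
Qed.

Section HilbertFunction.
Variables (n : nat) (F : fieldType) (I : ideal {mpoly F[n]}) (s : nat).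

Lemma ideal_le_exists : exists U : {vspace mpoly_le n F s},
  forall p : mpoly_le n F s, p \in U <-> (p : {mpoly F[n]}) \in I.
Proof.
apply: vspace_of_closed => [|a p q pI qI]; first exact: (rpred0 I).
rewrite /= -mul_mpolyC; apply: (rpredD (S := I)) => //.
exact: (rpredZ (s := I) a%:MP).
Qed.

Definition ideal_le : {vspace mpoly_le n F s} := sval (cid ideal_le_exists).

Lemma mem_ideal_le (p : mpoly_le n F s) :
  (p \in ideal_le) = ((p : {mpoly F[n]}) \in I).
Proof. by apply/idP/idP; rewrite /ideal_le; case: cid => U /= /(_ p) []. Qed.

Definition hilbert_function : nat := \dim {: quot_space ideal_le}.

End HilbertFunction.

Section Distances.
Variables (R : realType) (n : nat).

(* The norm of 'rV[R]_n in mathcomp-analysis is the sup norm. *)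
Definition edist (x y : 'rV[R]_n) : R :=
  Num.sqrt (\sum_(i < n) (x 0 i - y 0 i) ^+ 2).

Definition distances (A : set 'rV[R]_n) : set R :=
  [set edist p.1 p.2 | p in [set p | [/\ A p.1, A p.2 & p.1 != p.2]]].

Definition s_distance_set (s : nat) (A : set 'rV[R]_n) : Prop :=
  (distances A #<= `I_s)%card.

Definition vanishes_on (p : {mpoly R[n]}) (A : set 'rV[R]_n) : Prop :=
  forall x, A x -> p.@[x 0] = 0.

End Distances.

(* Main.v *)
Require Import Defs.
From HB Require Import structures.
From mathcomp Require Import all_boot all_order all_algebra finmap.
From mathcomp Require Import boolp classical_sets functions cardinality reals.
From mathcomp Require Import mpoly ring zify.

(* The argument is that of Petrov and Pohoata. If more than h(s) points x_i of
   A are given, some nonzero weights c_i annihilate all polynomials of degree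
   at most s on them. The polynomial F(x, y) = \prod_d (d^2 - |x - y|^2), over
   the at most s distances d of A, has degree at most 2s, hence each of its
   monomials has degree at most s in x or in y, and the quadratic form
   \sum_(i, j) F(x_i, x_j) c_i c_j vanishes. But F(x_i, x_j) = 0 for i != j, so
   this form is a positive multiple of \sum_i c_i^2. *)

Set Implicit Arguments.
Unset Strict Implicit.
Unset Printing Implicit Defensive.

Import Order.TTheory GRing.Theory Num.Theory.

Local Open Scope ring_scope.
Local Open Scope quotient_scope.

Lemma msizeXiM n (R : idomainType) (k : 'I_n) (p : {mpoly R[n]}) :
  (msize ('X_k * p) <= (msize p).+1)%N.
Proof.
have [->|p0] := eqVneq p 0; first by rewrite mulr0 msize0.
by rewrite msizeM ?msizeX ?mdeg1 // -msize_poly_eq0 msizeX.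
Qed.

Section Annihilator.
Variables (R : idomainType) (n m s : nat).
Variables (x : 'I_m -> 'rV[R]_n) (c : 'I_m -> R).
Hypothesis c_annih : forall p : {mpoly R[n]}, (msize p <= s.+1)%N ->
  \sum_i c i * p.@[x i 0] = 0.

(* Each monomial of the product has degree at most [s] in one of [x i], [x j]. *)
Lemma annih_prod_sqdist (t : seq R) (p q : {mpoly R[n]}) :
  (msize p + msize q + (size t).*2 <= s.*2.+2)%N ->
  \sum_i \sum_j c i * p.@[x i 0] * (c j * q.@[x j 0]) *
    \prod_(d <- t) (d - \sum_k (x i 0 k - x j 0 k) ^+ 2) = 0.
Proof.
elim: t p q => [|d t IHt] p q /= le_s.
  under eq_bigr do under eq_bigr do rewrite big_nil mulr1.
  (* The double sum splits into a product of two single sums. The sizes of [p] and [q] add up to at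
     most [2s + 2], so one of them is at most [s + 1]. *)
  under eq_bigr do rewrite -mulr_sumr; rewrite -mulr_suml.
  have [/c_annih -> | lt_p] := leqP (msize p) s.+1; first by rewrite mul0r.
  by rewrite [X in _ * X]c_annih ?mulr0 //; lia.
pose S p q i j := c i * p.@[x i 0] * (c j * q.@[x j 0]) *
  \prod_(d <- t) (d - \sum_k (x i 0 k - x j 0 k) ^+ 2).
(* Removing the factor of [d] frees 2 in the size budget, which pays for two more variables in [p]
   and [q] together. *)
have S0 p' q' : (msize p' + msize q' <= (msize p + msize q).+2)%N ->
    \sum_i \sum_j S p' q' i j = 0.
  by move=> le_pq; apply: IHt; lia.
(* Expand each square [(x_k - y_k)^2] and absorb [x_k] into [p] and [y_k] into [q]. *)
transitivity (\sum_i \sum_j (d * S p q i j - \sum_k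
    (S ('X_k * ('X_k * p)) q i j + S p ('X_k * ('X_k * q)) i j
     - 2 * S ('X_k * p) ('X_k * q) i j))).
  apply: eq_bigr => i _; apply: eq_bigr => j _.
  rewrite big_cons mulrCA mulrBl; congr (_ - _); rewrite mulr_suml.
  by apply: eq_bigr => k _; rewrite /S !mevalM !mevalXU; ring.
under eq_bigr do rewrite sumrB -mulr_sumr exchange_big /=.
rewrite sumrB -mulr_sumr S0 ?leqW // mulr0 exchange_big big1 ?subr0 // => k _.
under eq_bigr do rewrite sumrB big_split -mulr_sumr /=.
rewrite sumrB big_split -mulr_sumr /= !S0 ?addr0 ?mulr0 ?subr0 //.
- by have := msizeXiM k p; have := msizeXiM k q; lia.
- by have := msizeXiM k q; have := msizeXiM k ('X_k * q); lia.
- by have := msizeXiM k p; have := msizeXiM k ('X_k * p); lia.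
Qed.

End Annihilator.

(** Finiteness of [A] comes out of the bound, as an infinite set has finite subsets with more than
    [k] elements. *)
Lemma card_le_fsubset (T : choiceType) (A : set T) k :
  (forall B : {fset T}, ([set` B] `<=` A)%classic -> (#|` B| <= k)%N) -> (A #<= `I_k)%card.
Proof.
move=> le_k; have [/finite_setP[m Am]|A_inf] := pselect (finite_set A).
  have /card_eq_fsetP : ([set` fset_set A]%classic #= `I_m)%card.
    by rewrite fset_setK //; apply/finite_setP; exists m.
  rewrite (card_le_eql Am) card_le_II => <-; apply: le_k.
  by rewrite fset_setK //; apply/finite_setP; exists m.
have [B BA] := infinite_set_fset k.+1 A_inf.
by rewrite ltnNge le_k.
Qed.

Section Euclidean.
Variables (R : realType) (n : nat).
Implicit Types x y : 'rV[R]_n.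

Lemma sqr_edist x y : edist x y ^+ 2 = \sum_k (x 0 k - y 0 k) ^+ 2.
Proof. by rewrite sqr_sqrtr // sumr_ge0 // => k _; apply: sqr_ge0. Qed.

Lemma edist_eq0 x y : (edist x y == 0) = (x == y).
Proof.
rewrite -sqrf_eq0 sqr_edist psumr_eq0 => [|k _]; last exact: sqr_ge0.
apply/allP/eqP => [xy0|-> k _]; last by rewrite subrr expr0n eqxx.
apply/rowP => k; apply/eqP; rewrite -subr_eq0 -sqrf_eq0.
by apply: implyP (xy0 k _) _; rewrite ?mem_index_enum.
Qed.

Lemma s_distance_set_seq s (A : set 'rV[R]_n) : s_distance_set s A ->
  exists2 t : seq R, (size t <= s)%N & distances A = [set` t]%classic.
Proof.
move=> dA; have fin_d : finite_set (distances A).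
  exact: card_le_finite dA (finite_II _).
have [m dm] := (finite_setP _).1 fin_d.
exists (fset_set (distances A)); last by rewrite fset_setK.
by rewrite [size _](card_fset_set dm) -card_le_II -(card_le_eql dm).
Qed.

End Euclidean.

Section Evaluation.
Variables (F : fieldType) (n s : nat) (I : ideal {mpoly F[n]}).

(** Since [I] vanishes at the points, evaluation there gives [m] linear forms on the quotient, whose
    dimension is less than [m]; [c] is a linear relation between them. *)
Lemma exists_annih_gt_hilbert_function m (x : 'I_m -> 'rV[F]_n) :
    (forall p i, p \in I -> p.@[x i 0] = 0) -> (hilbert_function I s < m)%N ->
  exists2 c : 'rV[F]_m, c != 0 & forall p : {mpoly F[n]},
    (msize p <= s.+1)%N -> \sum_i c 0 i * p.@[x i 0] = 0.
Proof.
move=> I0 lt_m; pose U := ideal_le I s; pose Q := quot_space U.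
pose ev i (u : Q) := (repr (u : Quotient.quot U) : mpoly_le n F s).@[x i 0].
have evE i (p : mpoly_le n F s) : ev i (\pi_(Quotient.quot U) p) = p.@[x i 0].
  apply/eqP; rewrite -subr_eq0 -mevalB; apply/eqP/I0.
  by rewrite -[_ - _]/(val (repr _ - p)) -mem_ideal_le; apply/pi_eqP; rewrite reprK.
have ev_lin i : linear (ev i : Q -> F^o).
  move=> a; elim/quot_spaceW => p; elim/quot_spaceW => q.
  have -> : a *: (\pi_(Quotient.quot U) p : Q) + \pi_(Quotient.quot U) q
            = \pi_(Quotient.quot U) (a *: p + q).
    by rewrite [a *: _]pi_scale Defs.pi_add.
  by rewrite !evE mevalD mevalZ.
pose evL i : {linear Q -> F^o} := HB.pack (ev i) (GRing.isLinear.Build _ _ _ _ _ (ev_lin i)).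
(* Row [i] lists the values of the [i]-th form on a basis. With more rows than columns, the left
   kernel is nonzero. *)
pose M : 'M[F]_(m, \dim {: Q}) := \matrix_(i, j) ev i (vbasis {: Q})`_j.
have /rowV0Pn[c /sub_kermxP cM c0] : kermx M != 0.
  by rewrite -mxrank_eq0 mxrank_ker subn_eq0 -ltnNge (leq_ltn_trans (rank_leq_col M)).
exists c => // p le_p; pose P : mpoly_le n F s := MPolyLe le_p.
pose u : Q := \pi_(Quotient.quot U) P.
have evu i : p.@[x i 0] = \sum_j coord (vbasis {: Q}) j u * M i j.
  rewrite -(evE i P) -[LHS]/(evL i u) {1}(coord_vbasis (memvf u)) linear_sum.
  by apply: eq_bigr => j _; rewrite linearZ mxE.
under eq_bigr do rewrite evu mulr_sumr.
rewrite exchange_big big1 // => j _ /=.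
have /rowP/(_ j) := cM; rewrite !mxE => cMj.
by under eq_bigr do rewrite mulrCA; rewrite -mulr_sumr cMj mulr0.
Qed.

End Evaluation.

Theorem theorem1p3 (R : realType) (n s : nat) (hn : (1 <= n)%N)
    (I : ideal {mpoly R[n]}) (A : set 'rV[R]_n)
    (hA : s_distance_set s A)
    (hI : forall p : {mpoly R[n]}, p \in I -> vanishes_on p A) :
  (A #<= `I_(hilbert_function I s))%card.
Proof.
have [t le_t dA] := s_distance_set_seq hA.
apply: card_le_fsubset => B BA; rewrite leqNgt; apply/negP => lt_h.
pose x (i : 'I_#|` B|) := B`_i.
have xA i : A (x i) by apply: BA => /=; apply: mem_nth.
have [p i pI|c /negP c0 c_annih] := exists_annih_gt_hilbert_function (x := x) _ lt_h.
  exact: hI pI _ (xA i).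
(* The constant 1 has size 1, so the size condition reduces to [size t <= s]. *)
have := annih_prod_sqdist c_annih (t := [seq d ^+ 2 | d <- t]) (p := 1) (q := 1).
rewrite size_map !msize1 !add1n !addSn add0n !ltnS leq_double => /(_ le_t).
(* This is the value of the product at two equal points. It is positive because distances in [A] are
   taken between distinct points. *)
set w := \prod_(d <- [seq d ^+ 2 | d <- t]) d.
have w_gt0 : 0 < w.
  rewrite /w big_map big_seq prodr_gt0 // => d dt.
  have [[a b] /= [_ _ ab] <-] : distances A d by rewrite dA.
  by rewrite lt0r sqr_ge0 sqrf_eq0 edist_eq0 ab.
have x_inj i j : x i = x j -> i = j.
  by move/eqP; rewrite nth_uniq ?fset_uniq // => /eqP /val_inj.
have diag i : \sum_j c 0 i * 1.@[x i 0] * (c 0 j * 1.@[x j 0]) *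
    \prod_(d <- [seq d ^+ 2 | d <- t]) (d - \sum_k (x i 0 k - x j 0 k) ^+ 2)
    = c 0 i ^+ 2 * w.
  (* For [j != i] the factor belonging to the distance between [x i] and [x j] vanishes, so only
     [j = i] contributes. *)
  rewrite (bigD1 i) //= [X in _ + X]big1 ?addr0 => [|j ji].
    rewrite !meval1 !mulr1 -expr2; congr (_ * _); apply: eq_bigr => d _.
    by rewrite -sqr_edist (eqP (_ : edist _ _ == 0)) ?edist_eq0 // expr0n subr0.
  apply/eqP; rewrite mulf_eq0; apply/orP; right.
  have dt : edist (x i) (x j) \in t.
    have : distances A (edist (x i) (x j)).
      exists (x i, x j) => //=; split=> //.
      by apply: contraNneq ji => /x_inj ->.
    by rewrite dA.
  rewrite prodf_seq_eq0; apply/hasP; exists (edist (x i) (x j) ^+ 2).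
    exact: (map_f (fun d => d ^+ 2)).
  by rewrite /= sqr_edist subrr.
under eq_bigr do rewrite diag.
rewrite -mulr_suml => /eqP; rewrite mulf_eq0 (gt_eqF w_gt0) orbF.
rewrite psumr_eq0 => [/allP c2|i _]; last exact: sqr_ge0.
apply: c0; apply/eqP/rowP => i; rewrite mxE.
by apply/eqP; rewrite -sqrf_eq0; apply: (implyP (c2 i _)); rewrite ?mem_index_enum.
Qed.
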